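(* (a) The function $$\phi:\ \gamma\mapsto\min\{\xi_2(f):\ f\in\mathcal B_{[-1,1]},\ f(\gamma)=0\}$$ is well-defined on $(\tfrac12,\alpha_2)$. It is continuous, decreasing, and satisfies $$\lim_{t\to\frac12+}\phi(t)=1,\qquad \lim_{t\to\alpha_2-}\phi(t)=\alpha_2.$$ (b) For every $\gamma\in(\tfrac12,\alpha_2)$ we have $$\gamma<\lambda<\phi(\gamma)\ \Longrightarrow\ (\gamma,\lambda)\notin\Omega_+.$$ (c) For every $\gamma\in(\tfrac12,\alpha_2)$ there exists a unique function in $\mathcal B_{[-1,1]}$ which vanishes at $\gamma$ and $\phi(\gamma)$. Moreover, it is a $( * )$-function of the form $$h_k^{(a)}(x)=1-x-\cdots-x^{k-1}+ax^k+\frac{x^{k+1}}{1-x}\in\mathcal B_{[-1,1]}$$ (for some integer $k\ge1$ and $a\in[-1,1]$), so that $h_k^{(a)}(\gamma)=h_k^{(a)}(\phi(\gamma))=0$. Moreover, $(h_k^{(a)})'(\gamma)<0$ and $(h_k^{(a)})'(\phi(\gamma))>0$.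
   Context: $\mathcal B_{[-1,1]}=\{1+\sum_{n=1}^\infty a_nz^n:\ a_n\in[-1,1]\}$, a set of power series (convergent in the open unit disk). For a power series $f$ with bounded real coefficients, $\xi_1(f)\le\xi_2(f)\le\ldots$ denote its zeros in $(0,1)$ in increasing order, counted with multiplicity; by convention $\xi_k(f)=1$ if $f$ has fewer than $k$ zeros in $(0,1)$. $\Omega_+=\{(\gamma,\lambda):\ 0<\gamma<\lambda<1\text{ and there is } f\in\mathcal B_{[-1,1]}\text{ with } f(\gamma)=f(\lambda)=0\}$. $\alpha_2$ is the smallest $x\in(0,1)$ that is a zero of multiplicity at least $2$ of some power series in $\mathcal B_{[-1,1]}$. It is known that $\alpha_2\approx0.649138$ is a zero of $2x^5-8x^2+11x-4$. A $( * )$-function is a power series $h(x)=1+\sum_{n\ge1}a_nx^n$ for which there is an integer $\ell_1\ge1$ such that $a_n=-1$ for $1\le n\le\ell_1-1$, $a_{\ell_1}$ is an arbitrary real number, $a_n=1$ for $n\ge\ell_1+1$, and such that the sequence of coefficients of $h$ has exactly two sign changes. *)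

(* Defs.v *)
From Stdlib Require Import Reals List.
From Coquelicot Require Import Coquelicot.
Open Scope R_scope.

(* A power series is given by its coefficient sequence [a : nat -> R]; its sum
   is [PSeries a]. *)

Definition in_B (a : nat -> R) : Prop :=
  a 0%nat = 1 /\ forall n : nat, (1 <= n)%nat -> -1 <= a n <= 1.

(* [PSeries] is total, and evaluates to 0 where the partial sums tend to
   infinity (for instance at 1), hence the restriction to the unit disk. *)
Definition is_zero (a : nat -> R) (x : R) : Prop :=
  Rabs x < 1 /\ PSeries a x = 0.

(* [m = 0] means that [x] is not a zero. *)
Definition zero_multiplicity (a : nat -> R) (x : R) (m : nat) : Prop :=
  (forall j : nat, (j < m)%nat -> Derive_n (PSeries a) j x = 0) /\
  Derive_n (PSeries a) m x <> 0.

Definition has_card {T : Type} (P : T -> Prop) (n : nat) : Prop :=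
  exists l : list T, NoDup l /\ length l = n /\ forall x : T, In x l <-> P x.

(* [s 1 <= s 2 <= ...] lists the zeros in (0,1) in increasing order: each point
   of (0,1) occurs as often as its multiplicity, and the only other value
   allowed, 1, fills the sequence when there are finitely many zeros.  The
   value [s 0] is irrelevant. *)
Definition is_zero_sequence (a : nat -> R) (s : nat -> R) : Prop :=
  (forall k : nat, (1 <= k)%nat -> 0 < s k <= 1) /\
  (forall k : nat, (1 <= k)%nat -> s k <= s (S k)) /\
  (forall x : R, 0 < x < 1 ->
     exists m : nat, zero_multiplicity a x m /\
       has_card (fun k : nat => (1 <= k)%nat /\ s k = x) m).

Definition is_xi (k : nat) (a : nat -> R) (x : R) : Prop :=
  exists s : nat -> R, is_zero_sequence a s /\ s k = x.

Definition is_minimum (E : R -> Prop) (m : R) : Prop :=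
  E m /\ forall x : R, E x -> m <= x.

Definition Omega_plus (g l : R) : Prop :=
  0 < g /\ g < l /\ l < 1 /\
  exists a : nat -> R, in_B a /\ is_zero a g /\ is_zero a l.

Definition is_alpha2 (alpha2 : R) : Prop :=
  is_minimum
    (fun x : R => 0 < x < 1 /\
       exists (a : nat -> R) (m : nat),
         in_B a /\ (2 <= m)%nat /\ zero_multiplicity a x m)
    alpha2.

Definition xi2_values (g : R) (x : R) : Prop :=
  exists a : nat -> R, in_B a /\ is_zero a g /\ is_xi 2 a x.

(* Sign changes are counted ignoring zero coefficients. *)
Definition sign_change (a : nat -> R) (p : nat * nat) : Prop :=
  (fst p < snd p)%nat /\ a (fst p) * a (snd p) < 0 /\
  forall n : nat, (fst p < n < snd p)%nat -> a n = 0.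

Definition star_function (a : nat -> R) : Prop :=
  a 0%nat = 1 /\
  (exists l1 : nat, (1 <= l1)%nat /\
     (forall n : nat, (1 <= n <= l1 - 1)%nat -> a n = -1) /\
     (forall n : nat, (l1 + 1 <= n)%nat -> a n = 1)) /\
  has_card (sign_change a) 2.

(* For [k = 1] the sum, over 1 <= j <= 0, is empty. *)
Definition h (k : nat) (a : R) (x : R) : R :=
  1 - sum_n_m (fun j : nat => x ^ j) 1 (k - 1) + a * x ^ k
    + x ^ (k + 1) / (1 - x).

(* Main.v *)
(* Let [h_k^(a)] be the candidate star functions.  They are totally ordered
   pointwise on (0,1), and the one vanishing at a given [g > 1/2] is extremal:
   for [f] in the class with [f(g) = 0], the coefficients of [h - f] have at most
   one sign change, so [h - f] is negative before [g] and positive after it.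
   Hence [f] is nonzero wherever [h] is negative, that is, strictly between [g]
   and the other zero of [h], which is therefore [phi g].

   The derivative of [h] also has one sign change in its coefficients, so [h]
   decreases and then increases.  If its minimum is nonpositive and attained
   at [x], then [(1-s) h + s] is in the class and has a double zero at [x] for a
   suitable [s], so [alpha2 <= x].  It follows that the star function vanishing
   at [alpha2] is nonnegative with a double zero there, that [g < alpha2] is
   always the smaller zero, and that every [l] in (alpha2,1) is the larger zero
   of a star function.  Thus [phi] is a decreasing map onto an interval, hence
   continuous with the stated limits. *)
Require Import Defs.
From Stdlib Require Import Reals List Arith Lra Lia Classical FunctionalExtensionality.
From Stdlib Require Import IndefiniteDescription.
From Coquelicot Require Import Coquelicot.
Open Scope R_scope.

(** * Positivity of power series on (0,1) *)

Lemma Series_pos (u : nat -> R) (N : nat) :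
  ex_series u -> (forall n, 0 <= u n) -> 0 < u N -> 0 < Series u.
Proof.
  intros hu pos posN.
  assert (ge : sum_f_R0 u N <= Series u).
  { rewrite (Series_incr_n u (S N)); [simpl pred | lia | exact hu].
    assert (0 <= Series (fun k => u (S N + k)%nat)); [ | lra].
    replace 0 with (Series (fun n => 0 * u (S N + n)%nat))
      by (rewrite Series_scal_l; ring).
    apply Series_le; [ | now apply (ex_series_incr_n u (S N))].
    intros n; rewrite Rmult_0_l; split; [lra | apply pos]. }
  apply Rlt_le_trans with (2 := ge).
  destruct N as [|N]; simpl; [exact posN | ].
  pose proof (cond_pos_sum u N pos); lra.
Qed.

Lemma inside_unit_disk (b : nat -> R) (x : R) :
  Rbar_le 1 (CV_radius b) -> 0 <= x < 1 -> Rbar_lt (Rabs x) (CV_radius b).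
Proof.
  intros rad hx. apply Rbar_lt_le_trans with (2 := rad).
  rewrite Rabs_pos_eq by lra. simpl; lra.
Qed.

Lemma ex_series_inside (b : nat -> R) (x : R) :
  Rbar_le 1 (CV_radius b) -> 0 <= x < 1 ->
  ex_series (fun n => b n * x ^ n).
Proof.
  intros rad hx. apply ex_pseries_R, CV_radius_inside.
  now apply inside_unit_disk.
Qed.

Lemma ex_pseries_inside (b : nat -> R) (x : R) :
  Rbar_le 1 (CV_radius b) -> 0 <= x < 1 -> ex_pseries b x.
Proof. intros. now apply CV_radius_inside, inside_unit_disk. Qed.

Lemma radius_derive (b : nat -> R) :
  Rbar_le 1 (CV_radius b) -> Rbar_le 1 (CV_radius (PS_derive b)).
Proof. now rewrite CV_radius_derive. Qed.

Lemma radius_minus (b c : nat -> R) :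
  Rbar_le 1 (CV_radius b) -> Rbar_le 1 (CV_radius c) ->
  Rbar_le 1 (CV_radius (PS_minus b c)).
Proof.
  intros rb rc.
  apply Rbar_le_trans with (2 := CV_radius_plus b (PS_opp c)).
  rewrite CV_radius_opp. now apply Rbar_min_case.
Qed.

Lemma PSeries_pos (b : nat -> R) (x : R) (N : nat) :
  Rbar_le 1 (CV_radius b) -> 0 < x < 1 ->
  (forall n, 0 <= b n) -> b N <> 0 -> 0 < PSeries b x.
Proof.
  intros rad hx pos nz. apply (Series_pos _ N).
  - apply ex_series_inside; [exact rad | lra].
  - intros n. apply Rmult_le_pos; [apply pos | apply pow_le; lra].
  - apply Rmult_lt_0_compat; [specialize (pos N); lra | apply pow_lt; lra].
Qed.

(** * Power series whose coefficients change sign at most once *)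

Lemma pow_cross_lt (x y : R) (i j : nat) :
  0 < x < y -> (i < j)%nat -> x ^ j * y ^ i < y ^ j * x ^ i.
Proof.
  intros hxy hij. replace j with (i + S (j - S i))%nat by lia.
  rewrite !pow_add.
  assert (0 < x ^ i) by (apply pow_lt; lra).
  assert (0 < y ^ i) by (apply pow_lt; lra).
  assert (x ^ S (j - S i) < y ^ S (j - S i)).
  { clear - hxy. induction (j - S i)%nat as [|m IH]; [simpl; lra | ].
    rewrite <- !(tech_pow_Rmult _ (S m)).
    apply Rmult_le_0_lt_compat; try lra.
    apply pow_le; lra. }
  assert (0 < x ^ i * y ^ i) by now apply Rmult_lt_0_compat.
  nra.
Qed.

(** The coefficient at [k] itself is free. The last clause excludes the monomials [c x^k], for which
    the quotient by [x^k] is constant; it makes the inequalities below strict. *)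
Definition single_sign_change (b : nat -> R) (k : nat) : Prop :=
  Rbar_le 1 (CV_radius b) /\
  (forall n, (n < k)%nat -> b n <= 0) /\ (forall n, (k < n)%nat -> 0 <= b n) /\
  exists N, N <> k /\ b N <> 0.

(* Each term of [y^k G(x)] is at most the same term of [x^k G(y)]: the
   quotient [G(x)/x^k] is strictly increasing. *)
Lemma single_sign_change_lt (b : nat -> R) (k : nat) (x y : R) :
  single_sign_change b k -> 0 < x < y -> y < 1 ->
  PSeries b x * y ^ k < PSeries b y * x ^ k.
Proof.
  intros (rad & neg & pos & N & hN & bN) hxy hy. unfold PSeries.
  rewrite <- !Series_scal_r. apply Rlt_0_minus.
  assert (ex : forall z w, 0 < z < 1 ->
             ex_series (fun n => b n * z ^ n * w)).
  { intros z w hz. apply ex_series_scal_r, ex_series_inside; [exact rad|lra]. }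
  rewrite <- Series_minus by (apply ex; lra).
  apply (Series_pos _ N).
  - apply (ex_series_minus (V := R_NormedModule));
      apply ex; lra.
  - intros n. destruct (Nat.lt_trichotomy n k) as [lt | [-> | gt]].
    + pose proof (neg n lt). pose proof (pow_cross_lt x y n k hxy lt). nra.
    + right. ring.
    + pose proof (pos n gt). pose proof (pow_cross_lt x y k n hxy gt). nra.
  - destruct (proj1 (Nat.lt_gt_cases N k) hN) as [lt | gt].
    + pose proof (neg N lt). pose proof (pow_cross_lt x y N k hxy lt). nra.
    + pose proof (pos N gt). pose proof (pow_cross_lt x y k N hxy gt). nra.
Qed.

(** Infinitesimal form of the monotonicity of [G(x)/x^k]: the terms of [x G' - k G] are
    [(n - k) b_n x^n], nonnegative on both sides of [k] and positive at [N]. *)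
Lemma single_sign_change_derive (b : nat -> R) (k : nat) (x : R) :
  single_sign_change b k -> 0 < x < 1 ->
  INR k * PSeries b x < x * PSeries (PS_derive b) x.
Proof.
  intros (rad & neg & pos & N & hN & bN) hx.
  rewrite <- PSeries_incr_1. unfold PSeries.
  rewrite <- Series_scal_l. apply Rlt_0_minus.
  assert (rad' : Rbar_le 1 (CV_radius (PS_incr_1 (PS_derive b)))).
  { now rewrite CV_radius_incr_1; apply radius_derive. }
  assert (term : forall n, PS_incr_1 (PS_derive b) n = INR n * b n).
  { intros [|n]; [simpl; unfold zero; simpl; ring | reflexivity]. }
  rewrite <- Series_minus;
    [ | apply ex_series_inside; [exact rad' | lra]
    | apply (ex_series_scal_l (V := R_NormedModule)), ex_series_inside;
      [exact rad | lra]].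
  apply (Series_pos _ N).
  - apply (ex_series_minus (V := R_NormedModule));
      [ | apply (ex_series_scal_l (V := R_NormedModule))];
      apply ex_series_inside; trivial; lra.
  - intros n. rewrite term.
    assert (0 < x ^ n) by (apply pow_lt; lra).
    replace (_ - _) with ((INR n - INR k) * b n * x ^ n) by ring.
    apply Rmult_le_pos; [ | lra].
    destruct (Nat.lt_trichotomy n k) as [lt | [-> | gt]].
    + pose proof (neg n lt). pose proof (lt_INR n k lt). nra.
    + right; ring.
    + pose proof (pos n gt). pose proof (lt_INR k n gt). nra.
  - rewrite term.
    assert (0 < x ^ N) by (apply pow_lt; lra).
    replace (_ - _) with ((INR N - INR k) * b N * x ^ N) by ring.
    apply Rmult_lt_0_compat; [ | lra].
    destruct (proj1 (Nat.lt_gt_cases N k) hN) as [lt | gt].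
    + pose proof (neg N lt). pose proof (lt_INR N k lt). nra.
    + pose proof (pos N gt). pose proof (lt_INR k N gt). nra.
Qed.

(** Since [G(x)/x^k] increases, nonnegative values propagate to the right and, in the next lemma,
    nonpositive values to the left. *)
Lemma single_sign_change_right (b : nat -> R) (k : nat) (x y : R) :
  single_sign_change b k -> 0 < x < y -> y < 1 -> 0 <= PSeries b x -> 0 < PSeries b y.
Proof.
  intros hb hxy hy gx. pose proof (single_sign_change_lt b k x y hb hxy hy).
  assert (0 < x ^ k) by (apply pow_lt; lra).
  assert (0 < y ^ k) by (apply pow_lt; lra). nra.
Qed.

Lemma single_sign_change_left (b : nat -> R) (k : nat) (x y : R) :
  single_sign_change b k -> 0 < x < y -> y < 1 -> PSeries b y <= 0 -> PSeries b x < 0.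
Proof.
  intros hb hxy hy gx. pose proof (single_sign_change_lt b k x y hb hxy hy).
  assert (0 < x ^ k) by (apply pow_lt; lra).
  assert (0 < y ^ k) by (apply pow_lt; lra). nra.
Qed.


(** * The star functions and their closed form *)

Lemma in_B_radius (f : nat -> R) : in_B f -> Rbar_le 1 (CV_radius f).
Proof.
  intros [f0 fb]. destruct (CV_radius_bounded f) as [ub _].
  apply (ub 1). exists 1. intros n. rewrite pow1, Rmult_1_r.
  destruct n as [|n]; [rewrite f0, Rabs_R1; lra | ].
  apply Rabs_le, fb; lia.
Qed.

(* The coefficients of [h_(j+1)^(a)]: with this shift of index both the
   coefficient [a] and the sign change of the derivative come after [j]
   coefficients [-1]. *)
Definition star (j : nat) (a : R) (n : nat) : R :=
  match n with
  | O => 1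
  | S m => if lt_dec m j then -1 else if Nat.eq_dec m j then a else 1
  end.

Lemma star_lt (j : nat) (a : R) (n : nat) : (n < j)%nat -> star j a (S n) = -1.
Proof. intros H; simpl; destruct (lt_dec n j); [easy | lia]. Qed.

Lemma star_eq (j : nat) (a : R) : star j a (S j) = a.
Proof.
  simpl; destruct (lt_dec j j); [lia | ]; destruct (Nat.eq_dec j j); easy.
Qed.

Lemma star_gt (j : nat) (a : R) (n : nat) : (j < n)%nat -> star j a (S n) = 1.
Proof.
  intros H; simpl; destruct (lt_dec n j); [lia | ].
  destruct (Nat.eq_dec n j); [lia | easy].
Qed.

Lemma star_in_B (j : nat) (a : R) : -1 <= a <= 1 -> in_B (star j a).
Proof.
  intros ha; split; [easy | ]. intros [|n] hn; [lia | simpl].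
  destruct (lt_dec n j); [lra | ]. destruct (Nat.eq_dec n j); lra.
Qed.

Lemma star_radius (j : nat) (a : R) : Rbar_le 1 (CV_radius (star j a)).
Proof.
  destruct (CV_radius_bounded (star j a)) as [ub _].
  apply (ub 1). exists (Rmax 1 (Rabs a)). intros n.
  rewrite pow1, Rmult_1_r.
  pose proof (Rmax_l 1 (Rabs a)). pose proof (Rmax_r 1 (Rabs a)).
  assert (Rabs 1 = 1) by apply Rabs_R1.
  assert (Rabs (-1) = 1) by (rewrite Rabs_left; lra).
  destruct n as [|n]; simpl; [lra | ].
  destruct (lt_dec n j); [lra | ]. destruct (Nat.eq_dec n j); lra.
Qed.

(** The constant coefficient 1 is removed because the tail obeys a recursion in [j]: the tail for
    [j + 1] is -1 plus [x] times the tail for [j]. The factor [1 - x] clears the denominator of the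
    geometric series. *)
Lemma PSeries_star_tail (j : nat) (a x : R) :
  Rabs x < 1 ->
  (1 - x) * PSeries (fun n => star j a (S n)) x
  = - (1 - x ^ j) + a * x ^ j * (1 - x) + x ^ (S j).
Proof.
  intros hx.
  assert (x <> 1) by (intros ->; rewrite Rabs_R1 in hx; lra).
  assert (ex : forall i, ex_pseries (PS_decr_1 (star i a)) x).
  { intros i. apply CV_radius_inside. rewrite CV_radius_decr_1.
    apply Rbar_lt_le_trans with (2 := star_radius i a). exact hx. }
  induction j as [|j IH].
  - rewrite PSeries_decr_1 by apply ex.
    rewrite (PSeries_ext _ (fun _ => 1)) by reflexivity.
    unfold PSeries at 1.
    rewrite (Series_ext _ (fun n => x ^ n)) by (intros; ring).
    rewrite Series_geom by exact hx. rewrite star_eq. simpl. field. lra.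
  - rewrite PSeries_decr_1 by apply ex.
    rewrite (PSeries_ext _ (fun n => star j a (S n))).
    + rewrite star_lt by lia. rewrite Rmult_plus_distr_l.
      replace ((1 - x) * (x * PSeries (fun n => star j a (S n)) x))
        with (x * ((1 - x) * PSeries (fun n => star j a (S n)) x)) by ring.
      rewrite IH. simpl. ring.
    + intros n. unfold PS_decr_1. destruct (Nat.lt_trichotomy n j) as [L|[->|G]].
      * now rewrite !star_lt by lia.
      * now rewrite !star_eq.
      * now rewrite !star_gt by lia.
Qed.

Lemma PSeries_star (j : nat) (a x : R) :
  Rabs x < 1 ->
  (1 - x) * PSeries (star j a) x
  = 1 - 2 * x + (1 + a) * x ^ (S j) * (1 - x) + 2 * x ^ (S (S j)).
Proof.
  intros hx. rewrite PSeries_decr_1.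
  - rewrite Rmult_plus_distr_l.
    replace (_ * (x * _))
      with (x * ((1 - x) * PSeries (fun n => star j a (S n)) x)) by
      (unfold PS_decr_1; ring).
    rewrite PSeries_star_tail by exact hx. simpl. ring.
  - apply CV_radius_inside.
    apply Rbar_lt_le_trans with (2 := star_radius j a). exact hx.
Qed.

Lemma PSeries_star_h (j : nat) (a x : R) :
  Rabs x < 1 -> PSeries (star j a) x = h (S j) a x.
Proof.
  intros hx.
  assert (hx1 : x <> 1) by (intros ->; rewrite Rabs_R1 in hx; lra).
  apply (Rmult_eq_reg_l (1 - x)); [ | lra].
  rewrite PSeries_star by exact hx. unfold h.
  replace (S j - 1)%nat with j by lia.
  replace (S j + 1)%nat with (S (S j)) by lia.
  assert (sum : (1 - x) * sum_n_m (fun i => x ^ i) 1 j = x - x ^ (S j)).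
  { clear a. induction j as [|j IH].
    - rewrite sum_n_m_zero by lia. unfold zero; simpl. ring.
    - rewrite sum_n_Sm by lia. unfold plus; simpl.
      rewrite Rmult_plus_distr_l, IH. simpl. ring. }
  replace (sum_n_m _ _ _) with ((x - x ^ S j) / (1 - x))
    by (rewrite <- sum; field; lra).
  simpl. field. lra.
Qed.

Lemma star_derive_sign_change (j : nat) (a : R) :
  (1 <= j)%nat -> single_sign_change (PS_derive (star j a)) j.
Proof.
  intros hj. unfold PS_derive. repeat split.
  - apply radius_derive, star_radius.
  - intros n hn. rewrite star_lt by exact hn. pose proof (pos_INR (S n)). lra.
  - intros n hn. rewrite star_gt by exact hn. pose proof (pos_INR (S n)). lra.
  - exists 0%nat. split; [lia | ]. rewrite star_lt by lia. simpl; lra.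
Qed.

(** * Calculus of power series inside the unit disk *)

Lemma is_derive_inside (b : nat -> R) (x : R) :
  Rbar_le 1 (CV_radius b) -> 0 <= x < 1 ->
  is_derive (PSeries b) x (PSeries (PS_derive b) x).
Proof. intros; now apply is_derive_PSeries, inside_unit_disk. Qed.

Lemma continuity_inside (b : nat -> R) (x : R) :
  Rbar_le 1 (CV_radius b) -> 0 <= x < 1 -> continuity_pt (PSeries b) x.
Proof. intros; now apply PSeries_continuity, inside_unit_disk. Qed.

Lemma MVT_inside (b : nat -> R) (x y : R) :
  Rbar_le 1 (CV_radius b) -> 0 <= x -> x < y -> y < 1 ->
  exists c, x < c < y /\
    PSeries b y - PSeries b x = PSeries (PS_derive b) c * (y - x).
Proof.
  intros rad hx hxy hy.
  destruct (MVT_cor2 (PSeries b) (PSeries (PS_derive b)) x y hxy) as (c & eq & hc).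
  - intros c hc. apply is_derive_Reals, is_derive_inside; [exact rad | lra].
  - now exists c.
Qed.

Lemma IVT_inside (b : nat -> R) (x y : R) :
  Rbar_le 1 (CV_radius b) -> 0 <= x < y -> y < 1 ->
  PSeries b x < 0 -> 0 < PSeries b y -> exists c, x < c < y /\ PSeries b c = 0.
Proof.
  intros rad hx hy neg pos.
  destruct (Ranalysis5.IVT_interv (PSeries b) x y) as (c & hc & eq); trivial.
  - intros c hc. apply continuity_inside; [exact rad | lra].
  - lra.
  - exists c; split; [ | exact eq].
    destruct hc as [[l | <-] [r | ->]]; lra.
Qed.

Lemma radius_opp (b : nat -> R) :
  Rbar_le 1 (CV_radius b) -> Rbar_le 1 (CV_radius (PS_opp b)).
Proof. now rewrite CV_radius_opp. Qed.

Lemma IVT_inside_decr (b : nat -> R) (x y : R) :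
  Rbar_le 1 (CV_radius b) -> 0 <= x < y -> y < 1 ->
  0 < PSeries b x -> PSeries b y < 0 -> exists c, x < c < y /\ PSeries b c = 0.
Proof.
  intros rad hx hy pos neg.
  destruct (IVT_inside (PS_opp b) x y) as (c & hc & eq); trivial.
  - now apply radius_opp.
  - rewrite PSeries_opp; lra.
  - rewrite PSeries_opp; lra.
  - exists c; rewrite PSeries_opp in eq; split; [exact hc | lra].
Qed.

(** * The shape of a single star function *)

Section Star.

Variables (j : nat) (a : R).
Hypothesis hj : (1 <= j)%nat.

Notation H := (PSeries (star j a)).
Notation D := (PSeries (PS_derive (star j a))).

Lemma star_derive_pos_right (x y : R) :
  0 < x < y -> y < 1 -> 0 <= D x -> 0 < D y.
Proof. exact (single_sign_change_right _ j x y (star_derive_sign_change j a hj)). Qed.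

Lemma star_derive_neg_left (x y : R) :
  0 < x < y -> y < 1 -> D y <= 0 -> D x < 0.
Proof. exact (single_sign_change_left _ j x y (star_derive_sign_change j a hj)). Qed.

Lemma star_increasing (x y : R) :
  0 < x < y -> y < 1 -> 0 <= D x -> H x < H y.
Proof.
  intros hxy hy dx.
  destruct (MVT_inside (star j a) x y) as (c & hc & eq);
    [apply star_radius | lra | lra | lra | ].
  assert (0 < D c) by (apply (star_derive_pos_right x); lra). nra.
Qed.

Lemma star_decreasing (x y : R) :
  0 <= x < y -> y < 1 -> D y <= 0 -> H y < H x.
Proof.
  intros hxy hy dy.
  destruct (MVT_inside (star j a) x y) as (c & hc & eq);
    [apply star_radius | lra | lra | lra | ].
  assert (D c < 0) by (apply (star_derive_neg_left c y); lra). nra.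
Qed.

(* [H] decreases up to its minimum, then increases. *)
Lemma star_zero_pair (g l : R) :
  0 < g < l -> l < 1 -> H g = 0 -> H l = 0 ->
  D g < 0 /\ 0 < D l /\ (forall x, 0 < x < g -> 0 < H x) /\
  (forall x, g < x < l -> H x < 0) /\ (forall x, l < x < 1 -> 0 < H x).
Proof.
  intros hg hl zg zl.
  (* By Rolle's theorem there is a critical point [c], which separates the decreasing branch from
     the increasing one. *)
  destruct (MVT_inside (star j a) g l) as (c & hc & eq);
    [apply star_radius | lra | lra | lra | ].
  assert (dc : D c = 0) by nra.
  assert (dg : D g < 0) by (apply (star_derive_neg_left g c); lra).
  assert (dl : 0 < D l) by (apply (star_derive_pos_right c l); lra).
  repeat split; trivial.
  - intros x hx. rewrite <- zg. apply star_decreasing; lra.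
  - intros x hx. destruct (Rle_lt_dec x c) as [le | gt].
    + rewrite <- zg. apply star_decreasing; [lra | lra | ].
      destruct le as [lt | ->]; [ | lra].
      left; apply (star_derive_neg_left x c); lra.
    + rewrite <- zl. apply star_increasing; [lra | lra | ].
      left; apply (star_derive_pos_right c x); lra.
  - intros x hx. rewrite <- zl. apply star_increasing; lra.
Qed.

(** In the closed form [PSeries_star] the right-hand side tends to 1 as [x] tends to 1; Bernoulli's
    inequality gives an explicit point. *)
Lemma star_pos_near_1 (g : R) :
  -1 <= a -> 0 < g < 1 -> exists p, g < p < 1 /\ 0 < H p.
Proof.
  intros ha hg.
  assert (bern : forall e n, 0 <= e <= 1 -> 1 - INR n * e <= (1 - e) ^ n).
  { intros e n he. induction n as [|n IH]; [simpl; lra | ].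
    rewrite S_INR. simpl. pose proof (pos_INR n).
    assert ((1 - e) * (1 - INR n * e) <= (1 - e) * (1 - e) ^ n)
      by (apply Rmult_le_compat_l; lra).
    assert (0 <= INR n * e * e) by (apply Rmult_le_pos; nra).
    nra. }
  set (n := S (S j)).
  assert (hn : 1 <= INR n) by (apply (le_INR 1); lia).
  (* At [1 - e] the right-hand side is at least [1 + 2e - 2ne], and the first bound makes this at
     least [2e]. The second bound keeps [1 - e] to the right of [g]. *)
  set (e := Rmin (/ (2 * INR n)) ((1 - g) / 2)).
  assert (e1 : e <= / (2 * INR n)) by apply Rmin_l.
  assert (e2 : e <= (1 - g) / 2) by apply Rmin_r.
  assert (e0 : 0 < e).
  { apply Rmin_glb_lt; [apply Rinv_0_lt_compat | ]; lra. }
  assert (e3 : 2 * INR n * e <= 1).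
  { apply Rmult_le_compat_l with (r := 2 * INR n) in e1; [ | lra].
    rewrite Rinv_r in e1; lra. }
  exists (1 - e). split; [lra | ].
  apply (Rmult_lt_reg_l (1 - (1 - e))); [lra | ].
  rewrite Rmult_0_r, PSeries_star by (rewrite Rabs_pos_eq; lra).
  fold n. specialize (bern e n).
  assert (0 < (1 - e) ^ S j) by (apply pow_lt; lra).
  assert (0 <= (1 + a) * (1 - e) ^ S j * (1 - (1 - e))).
  { apply Rmult_le_pos; [apply Rmult_le_pos | ]; lra. }
  lra.
Qed.

(** [H] falls at [g] but is positive at some [p > g], so [D] becomes positive in between and
    vanishes at some [e]. There [H] is negative, which brackets a zero between [e] and [p]. *)
Lemma star_second_zero (g : R) :
  -1 <= a -> 0 < g < 1 -> H g = 0 -> D g < 0 -> exists l, g < l < 1 /\ H l = 0.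
Proof.
  intros ha hg zg dg.
  destruct (star_pos_near_1 g ha) as (p & hp & Hp); [lra | ].
  destruct (MVT_inside (star j a) g p) as (c & hc & eq);
    [apply star_radius | lra | lra | lra | ].
  assert (dc : 0 < D c) by nra.
  destruct (IVT_inside (PS_derive (star j a)) g c) as (e & he & de);
    [apply radius_derive, star_radius | lra | lra | lra | lra | ].
  assert (He : H e < H g) by (apply star_decreasing; lra).
  destruct (IVT_inside (star j a) e p) as (l & hl & zl);
    [apply star_radius | lra | lra | lra | lra | ].
  exists l; split; [lra | exact zl].
Qed.

End Star.

(** * Star functions through a given zero *)

Lemma star_pos_le_half (j : nat) (a x : R) :
  -1 <= a -> 0 < x <= 1 / 2 -> 0 < PSeries (star j a) x.
Proof.
  intros ha hx. apply (Rmult_lt_reg_l (1 - x)); [lra | ].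
  rewrite Rmult_0_r, PSeries_star by (rewrite Rabs_pos_eq; lra).
  assert (0 < x ^ S (S j)) by (apply pow_lt; lra).
  assert (0 < x ^ S j) by (apply pow_lt; lra).
  assert (0 <= (1 + a) * x ^ S j * (1 - x)).
  { apply Rmult_le_pos; [apply Rmult_le_pos | ]; lra. }
  lra.
Qed.

(* For the least [j] with [2 g^(j+2) <= 2 g - 1], the value at [g] changes sign
   as [a] runs through [[-1,1]], and it is affine in [a]. *)
Lemma star_exists (g : R) :
  1 / 2 < g < 1 -> exists (j : nat) (a : R),
    (1 <= j)%nat /\ -1 <= a <= 1 /\ PSeries (star j a) g = 0.
Proof.
  intros hg.
  assert (small : exists n, 2 * g ^ S (S n) <= 2 * g - 1).
  { destruct (pow_lt_1_zero g) with (y := g - 1 / 2) as [N hN];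
      [rewrite Rabs_pos_eq; lra | lra | ].
    exists N. specialize (hN (S (S N))).
    rewrite Rabs_pos_eq in hN by (apply pow_le; lra).
    assert (g ^ S (S N) < g - 1 / 2) by (apply hN; lia). lra. }
  destruct small as [n hn].
  destruct (dec_inh_nat_subset_has_unique_least_element
    (fun n => 2 * g ^ S (S n) <= 2 * g - 1)) as (j & (hj & least) & _).
  - intros m. destruct (Rle_dec (2 * g ^ S (S m)) (2 * g - 1)); tauto.
  - now exists n.
  (* For [j = 0] the inequality would give [2 g^2 - 2 g + 1 <= 0], which is impossible. *)
  - assert (j1 : (1 <= j)%nat).
    { destruct j as [|j]; [simpl in hj; nra | lia]. }
    assert (prev : 2 * g - 1 < 2 * g ^ S j).
    { destruct j as [|j]; [lia | ].
      apply Rnot_le_lt. intros H. specialize (least _ H). lia. }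
    assert (p : 0 < g ^ S j) by (apply pow_lt; lra).
    (* [t] is [1 + a], solved from [PSeries_star]. The inequality at [j] gives [0 <= t], its failure
       at [j - 1] gives [t <= 2]. *)
    set (t := (2 * g - 1 - 2 * g ^ S (S j)) / (g ^ S j * (1 - g))).
    assert (d : 0 < g ^ S j * (1 - g)) by (apply Rmult_lt_0_compat; lra).
    assert (ht : t * (g ^ S j * (1 - g)) = 2 * g - 1 - 2 * g ^ S (S j)).
    { unfold t. field. split; lra. }
    assert (t0 : 0 <= t).
    { apply Rdiv_le_0_compat; lra. }
    assert (t2 : t <= 2).
    { apply (Rmult_le_reg_r (g ^ S j * (1 - g))); [exact d | ].
      rewrite ht. rewrite <- (tech_pow_Rmult _ (S j)). lra. }
    exists j, (t - 1). repeat split; [exact j1 | lra | lra | ].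
    apply (Rmult_eq_reg_l (1 - g)); [ | lra].
    rewrite Rmult_0_r, PSeries_star by (rewrite Rabs_pos_eq; lra).
    lra.
Qed.

(** * Comparison of star functions with each other and with the class *)

Lemma PSeries_lt_of_coeff_le (b c : nat -> R) (x : R) :
  Rbar_le 1 (CV_radius b) -> Rbar_le 1 (CV_radius c) -> 0 < x < 1 ->
  (forall n, b n <= c n) -> (exists n, b n <> c n) -> PSeries b x < PSeries c x.
Proof.
  intros rb rc hx le [N ne]. apply Rlt_0_minus.
  rewrite <- PSeries_minus by (apply ex_pseries_inside; trivial; lra).
  apply (PSeries_pos _ _ N); trivial.
  - now apply radius_minus.
  - intros n. unfold PS_minus, PS_plus, PS_opp, plus, opp; simpl.
    specialize (le n). lra.
  - unfold PS_minus, PS_plus, PS_opp, plus, opp; simpl. lra.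
Qed.

(** More coefficients -1 make a smaller function, and the free coefficient lies between the two
    levels -1 and 1. So the family is a chain, decreasing in [j] and, for equal [j], increasing in
    [a]. *)
Lemma star_coeff_total (j j' : nat) (a a' : R) :
  -1 <= a <= 1 -> -1 <= a' <= 1 ->
  (forall n, star j a n <= star j' a' n) \/ (forall n, star j' a' n <= star j a n).
Proof.
  assert (lt : forall i i' b b', (i < i')%nat -> -1 <= b <= 1 -> -1 <= b' <= 1 ->
            forall n, star i' b' n <= star i b n).
  { intros i i' b b' hi hb hb' [|n]; simpl; [lra | ].
    destruct (lt_dec n i), (lt_dec n i'), (Nat.eq_dec n i), (Nat.eq_dec n i');
      lra || lia. }
  intros ha ha'. destruct (Nat.lt_trichotomy j j') as [L | [-> | G]].
  - right. now apply lt.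
  - destruct (Rle_dec a a') as [le | ge]; [left | right]; intros [|n]; simpl;
      try lra; destruct (lt_dec n j'), (Nat.eq_dec n j'); lra.
  - left. now apply lt.
Qed.

(** A strict inequality at one point decides the direction of the coefficientwise order, hence the
    comparison everywhere on (0,1). This carries comparisons from one zero to another. *)
Lemma star_total (j j' : nat) (a a' x y : R) :
  -1 <= a <= 1 -> -1 <= a' <= 1 -> 0 < x < 1 -> 0 < y < 1 ->
  PSeries (star j a) x < PSeries (star j' a') x ->
  PSeries (star j a) y < PSeries (star j' a') y.
Proof.
  intros ha ha' hx hy lt.
  assert (ne : exists n, star j a n <> star j' a' n).
  { apply NNPP. intros no. apply (Rlt_irrefl (PSeries (star j a) x)).
    rewrite (PSeries_ext _ (star j' a')) at 2; [exact lt | ].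
    intros n. apply NNPP. intros H. apply no. now exists n. }
  destruct (star_coeff_total j j' a a' ha ha') as [le | ge].
  - apply PSeries_lt_of_coeff_le; trivial; apply star_radius.
  - exfalso. apply (Rlt_asym _ _ lt).
    apply PSeries_lt_of_coeff_le; trivial; try apply star_radius.
    destruct ne as [n ne]; exists n; now apply not_eq_sym.
Qed.

(* [star j a - f] has at most one sign change, at the free coefficient. *)
Lemma star_extremal (f : nat -> R) (j : nat) (a g : R) :
  in_B f -> 0 < g < 1 -> PSeries f g = 0 -> PSeries (star j a) g = 0 ->
  f = star j a \/
  ((forall x, 0 < x < g -> PSeries (star j a) x < PSeries f x) /\
   (forall x, g < x < 1 -> PSeries f x < PSeries (star j a) x) /\
   PSeries (PS_derive f) g < PSeries (PS_derive (star j a)) g).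
Proof.
  intros hf hg zf zs.
  pose proof (in_B_radius f hf) as rf. pose proof (star_radius j a) as rs.
  set (b := PS_minus (star j a) f).
  assert (bE : forall n, b n = star j a n - f n) by reflexivity.
  assert (bP : forall x, 0 <= x < 1 ->
             PSeries b x = PSeries (star j a) x - PSeries f x).
  { intros x hx. apply PSeries_minus; now apply ex_pseries_inside. }
  destruct (classic (exists N, N <> S j /\ b N <> 0)) as [ne | eq].
  - right.
    assert (hb : single_sign_change b (S j)).
    { repeat split; trivial.
      - now apply radius_minus.
      - destruct hf as [f0 fb]. intros [|n] hn; rewrite bE; [simpl; lra | ].
        rewrite star_lt by lia. assert (1 <= S n)%nat by lia. specialize (fb _ H). lra.
      - destruct hf as [f0 fb]. intros [|n] hn; rewrite bE; [lia | ].
        rewrite star_gt by lia. assert (1 <= S n)%nat by lia.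
        specialize (fb _ H). lra. }
    repeat split.
    + intros x hx.
      pose proof (single_sign_change_left b (S j) x g hb).
      rewrite !bP in H by lra. lra.
    + intros x hx.
      pose proof (single_sign_change_right b (S j) g x hb).
      rewrite !bP in H by lra. lra.
    (* As [b] vanishes at [g], this inequality reduces to [0 < g b'(g)]. *)
    + pose proof (single_sign_change_derive b (S j) g hb hg) as lt.
      rewrite bP, zf, zs, Rminus_0_r, Rmult_0_r in lt by lra.
      assert (e : PSeries (PS_derive b) g =
        PSeries (PS_derive (star j a)) g - PSeries (PS_derive f) g).
      { rewrite <- PSeries_minus by (apply ex_pseries_inside;
          [now apply radius_derive | lra]).
        apply PSeries_ext. intros n.
        unfold PS_minus, PS_plus, PS_opp, PS_derive, plus, opp.
        rewrite bE. change (INR (S n) * (star j a (S n) - f (S n)) =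
          INR (S n) * star j a (S n) + - (INR (S n) * f (S n))). ring. }
      rewrite e in lt. nra.
  (* Here the difference is a monomial [c x^(j+1)]; its vanishing at [g > 0] forces [c = 0]. *)
  - left. extensionality n.
    assert (off : forall m, m <> S j -> b m = 0).
    { intros m hm. apply NNPP. intros H. apply eq. now exists m. }
    destruct (Nat.eq_dec n (S j)) as [-> | hn];
      [ | specialize (off n hn); rewrite bE in off; lra].
    assert (z : PSeries b g = 0) by (rewrite bP; lra).
    destruct (Rtotal_order (b (S j)) 0) as [neg | [zero | pos]].
    + assert (0 < PSeries (PS_opp b) g).
      { apply (PSeries_pos _ _ (S j)); trivial.
        - now apply radius_opp, radius_minus.
        - intros m. change (0 <= - b m).
          destruct (Nat.eq_dec m (S j)) as [-> | hm]; [lra | ].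
          rewrite (off m hm); lra.
        - change (- b (S j) <> 0). lra. }
      rewrite PSeries_opp in H. lra.
    + rewrite bE in zero. lra.
    + assert (0 < PSeries b g).
      { apply (PSeries_pos _ _ (S j)); trivial.
        - now apply radius_minus.
        - intros m. destruct (Nat.eq_dec m (S j)) as [-> | hm]; [lra | ].
          rewrite (off m hm); lra.
        - lra. }
      lra.
Qed.

(** * Double zeros and [alpha2] *)

Lemma star_derive2_pos (j : nat) (a x : R) :
  (1 <= j)%nat -> 0 < x < 1 -> PSeries (PS_derive (star j a)) x = 0 ->
  0 < PSeries (PS_derive (PS_derive (star j a))) x.
Proof.
  intros hj hx dx.
  (* Applied to [H'], the inequality reads [j H'(x) < x H''(x)]. *)
  pose proof (single_sign_change_derive _ j x (star_derive_sign_change j a hj) hx).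
  rewrite dx in H. nra.
Qed.

(* Mixing the function with the constant 1 lifts a nonpositive minimum to 0 and
   stays within the class. *)
Lemma alpha2_le_valley (alpha2 : R) (j : nat) (a x : R) :
  is_alpha2 alpha2 -> (1 <= j)%nat -> -1 <= a <= 1 -> 0 < x < 1 ->
  PSeries (PS_derive (star j a)) x = 0 -> PSeries (star j a) x <= 0 ->
  alpha2 <= x.
Proof.
  intros [_ least] hj ha hx dx neg. apply least. split; [exact hx | ].
  pose proof (star_radius j a) as rs.
  set (v := PSeries (star j a) x) in *.
  (* [s] solves [(1 - s) v + s = 0]; as [v <= 0], it lies in [0,1). *)
  set (s := - v / (1 - v)).
  assert (hs : s * (1 - v) = - v) by (unfold s; field; lra).
  assert (s0 : 0 <= s) by (apply Rdiv_le_0_compat; lra).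
  assert (s1 : s < 1) by nra.
  set (f := fun n => match n with O => 1 | S m => (1 - s) * star j a (S m) end).
  assert (hf : in_B f).
  { split; [reflexivity | ]. intros [|n] hn; [lia | ].
    destruct (star_in_B j a ha) as [_ hb]. specialize (hb _ hn).
    unfold f. split; nra. }
  pose proof (in_B_radius f hf) as rf.
  exists f, 2%nat. split; [exact hf | split; [lia | ]].
  assert (inside : Rbar_lt (Rabs x) (CV_radius f)).
  { apply inside_unit_disk; [exact rf | lra]. }
  assert (f0 : PSeries f x = 0).
  { rewrite PSeries_decr_1 by (apply ex_pseries_inside; [exact rf | lra]).
    rewrite (PSeries_ext _ (PS_scal (1 - s) (PS_decr_1 (star j a)))) by reflexivity.
    rewrite PSeries_scal.
    assert (e : v = 1 + x * PSeries (PS_decr_1 (star j a)) x).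
    { unfold v. rewrite PSeries_decr_1 by (apply ex_pseries_inside; [exact rs | lra]).
      reflexivity. }
    change (f 0%nat) with 1. nra. }
  assert (f1 : PSeries (PS_derive f) x = 0).
  { rewrite (PSeries_ext _ (PS_scal (1 - s) (PS_derive (star j a)))).
    - rewrite PSeries_scal, dx. ring.
    - intros n. unfold PS_derive, f.
      change (INR (S n) * ((1 - s) * star j a (S n))
              = (1 - s) * (INR (S n) * star j a (S n))). ring. }
  split.
  - intros [|[|m]] hm; [exact f0 | | lia].
    change (Derive (PSeries f) x = 0). now rewrite Derive_PSeries.
  (* The multiplicity is exactly 2, since the second derivative is positive. *)
  - rewrite Derive_n_PSeries by exact inside.
    rewrite (PSeries_ext _ (PS_scal (1 - s) (PS_derive (PS_derive (star j a))))).
    + rewrite PSeries_scal. pose proof (star_derive2_pos j a x hj hx dx). nra.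
    + intros n. unfold PS_derive_n.
      change (INR (fact (n + 2)) / INR (fact n) * f (n + 2)%nat
        = (1 - s) * (INR (S n) * (INR (S (S n)) * star j a (S (S n))))).
      replace (n + 2)%nat with (S (S n)) by lia.
      change (f (S (S n))) with ((1 - s) * star j a (S (S n))).
      rewrite !fact_simpl, !mult_INR. field. apply INR_fact_neq_0.
Qed.

(** Supplies the critical point for [alpha2_le_valley]. [H'] equals -1 at 0, so if it is positive at
    [g] it vanishes at some earlier [x], and [H] rises from there to 0 at [g]. Otherwise [g] itself
    serves. *)
Lemma star_valley (j : nat) (a g : R) :
  (1 <= j)%nat -> 0 < g < 1 -> PSeries (star j a) g = 0 ->
  0 <= PSeries (PS_derive (star j a)) g ->
  exists x, 0 < x <= g /\ PSeries (PS_derive (star j a)) x = 0 /\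
    PSeries (star j a) x <= 0 /\
    (0 < PSeries (PS_derive (star j a)) g -> x < g).
Proof.
  intros hj hg zg [dg | dg].
  - destruct (IVT_inside (PS_derive (star j a)) 0 g) as (x & hx & dx);
      [apply radius_derive, star_radius | lra | lra | | exact dg | ].
    + rewrite PSeries_0. unfold PS_derive. rewrite star_lt by lia. simpl; lra.
    + exists x. repeat split; try lra.
      rewrite <- zg. left. apply star_increasing; [exact hj | lra | lra | lra].
  - exists g. repeat split; lra.
Qed.

(** Its contrapositive shows that a star function vanishing at [g < alpha2] has negative derivative
    there, so that [g] is its smaller zero. The strict version settles the case [g = alpha2]. *)
Lemma alpha2_le_star_zero (alpha2 : R) (j : nat) (a g : R) :
  is_alpha2 alpha2 -> (1 <= j)%nat -> -1 <= a <= 1 -> 0 < g < 1 ->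
  PSeries (star j a) g = 0 -> 0 <= PSeries (PS_derive (star j a)) g ->
  alpha2 <= g /\ (0 < PSeries (PS_derive (star j a)) g -> alpha2 < g).
Proof.
  intros hal hj ha hg zg dg.
  destruct (star_valley j a g hj hg zg dg) as (x & hx & dx & zx & lt).
  assert (alpha2 <= x) by (apply (alpha2_le_valley alpha2 j a x); trivial; lra).
  split; [lra | ]. intros pos. specialize (lt pos). lra.
Qed.

(* Up to 1/2, any [f] in the class is at least [1 - x/(1-x) >= 0], and equality
   determines [f]. *)
Lemma no_double_zero_le_half (f : nat -> R) (x : R) :
  in_B f -> 0 < x <= 1 / 2 -> PSeries f x = 0 -> PSeries (PS_derive f) x <> 0.
Proof.
  intros hf hx zf. pose proof (in_B_radius f hf) as rf.
  set (F := fun n : nat => match n with O => 1 | S _ => -1 end).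
  assert (hF : in_B F).
  { split; [reflexivity | ]. intros [|n] hn; [lia | simpl; lra]. }
  pose proof (in_B_radius F hF) as rF.
  assert (Fx : 0 <= PSeries F x).
  { rewrite PSeries_decr_1 by (apply ex_pseries_inside; [exact rF | lra]).
    rewrite (PSeries_ext _ (PS_scal (-1) (fun _ => 1))).
    - rewrite PSeries_scal. unfold PSeries.
      rewrite (Series_ext _ (fun n => x ^ n)) by (intros; ring).
      rewrite Series_geom by (rewrite Rabs_pos_eq; lra).
      change (F 0%nat) with 1.
      apply (Rmult_le_reg_l (1 - x)); [lra | ].
      replace ((1 - x) * (1 + x * (-1 * / (1 - x)))) with (1 - 2 * x)
        by (field; lra). lra.
    - intros n. change (-1 = -1 * 1). ring. }
  assert (le : forall n, F n <= f n).
  { destruct hf as [f0 fb]. intros [|n]; simpl; [lra | ].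
    apply fb; lia. }
  assert (eq : forall n, F n = f n).
  { intros n. apply NNPP. intros ne.
    assert (PSeries F x < PSeries f x); [ | lra].
    apply PSeries_lt_of_coeff_le; trivial; [lra | now exists n]. }
  assert (0 < PSeries (PS_opp (PS_derive f)) x).
  { apply (PSeries_pos _ _ 0%nat); [ | lra | | ].
    - now apply radius_opp, radius_derive.
    - intros n. change (0 <= - (INR (S n) * f (S n))).
      rewrite <- eq. pose proof (pos_INR (S n)). simpl F. lra.
    - change (- (1 * f 1%nat) <> 0). rewrite <- eq. simpl. lra. }
  rewrite PSeries_opp in H. lra.
Qed.

(** Let [f] have a multiple zero at [alpha2]. By [star_extremal] the star function vanishing there
    has derivative at least [f'(alpha2) = 0]. A positive derivative would put its minimum further
    left and give [alpha2 < alpha2]. *)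
Lemma alpha2_star (alpha2 : R) :
  is_alpha2 alpha2 -> 1 / 2 < alpha2 < 1 /\
  exists (j : nat) (a : R), (1 <= j)%nat /\ -1 <= a <= 1 /\
    PSeries (star j a) alpha2 = 0 /\
    PSeries (PS_derive (star j a)) alpha2 = 0.
Proof.
  intros hal. destruct (hal) as [[h01 (f & m & hf & hm & zeros & _)] _].
  assert (zf : PSeries f alpha2 = 0) by (apply (zeros 0%nat); lia).
  assert (df : PSeries (PS_derive f) alpha2 = 0).
  { rewrite <- Derive_PSeries.
    - apply (zeros 1%nat); lia.
    - apply inside_unit_disk; [now apply in_B_radius | lra]. }
  assert (half : 1 / 2 < alpha2).
  { apply Rnot_le_lt. intros le.
    apply (no_double_zero_le_half f alpha2); trivial. lra. }
  split; [lra | ].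
  destruct (star_exists alpha2) as (j & a & hj & ha & z); [lra | ].
  exists j, a. repeat split; trivial; try lra.
  assert (dpos : 0 <= PSeries (PS_derive (star j a)) alpha2).
  { destruct (star_extremal f j a alpha2 hf h01 zf z) as [-> | (_ & _ & d)]; lra. }
  destruct (alpha2_le_star_zero alpha2 j a alpha2) as [_ lt]; trivial.
  destruct dpos as [pos | <-]; [specialize (lt pos); lra | reflexivity].
Qed.

(** * Counting sign changes and zeros *)

Lemma star_star_function (j : nat) (a : R) :
  (1 <= j)%nat -> star_function (star j a).
Proof.
  intros hj.
  assert (neg : forall n, (1 <= n <= j)%nat -> star j a n = -1).
  { intros [|n] hn; [lia | apply star_lt; lia]. }
  assert (pos : forall n, (S (S j) <= n)%nat -> star j a n = 1).
  { intros [|n] hn; [lia | apply star_gt; lia]. }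
  split; [reflexivity | split].
  - exists (S j). split; [lia | split].
    + intros n hn. apply neg. lia.
    + intros n hn. apply pos. lia.
  - pose proof (star_eq j a) as mid.
    assert (zero : star j a 0%nat = 1) by reflexivity.
    set (c := star j a) in *. clearbody c.
    assert (pos_cases : forall n,
      n = 0%nat \/ (1 <= n <= j)%nat \/ n = S j \/ (S (S j) <= n)%nat)
      by (intros; lia).
    (* The first sign change is always [(0, 1)]; the condition on [p'] sets it aside. The other one
       is [(j+1, j+2)] for [a < 0], [(j, j+2)] for [a = 0], where the zero coefficient is skipped,
       and [(j, j+1)] for [a > 0]. *)
    assert (last : exists p q, (1 <= p < q)%nat /\
              forall p' q', (1 <= p')%nat ->
                sign_change c (p', q') <-> (p', q') = (p, q)).
    { destruct (Rtotal_order a 0) as [L | [E | G]].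
      - exists (S j), (S (S j)). split; [lia | ]. intros p q hp. split.
        + intros (lt & prod & between); simpl in *.
          destruct (pos_cases p) as [? | [Hp | [-> | Hp]]]; [lia | | | ].
          * exfalso. destruct (pos_cases q) as [? | [Hq | [-> | Hq]]]; [lia | | | ].
            -- rewrite (neg p), (neg q) in prod by lia. lra.
            -- rewrite (neg p), mid in prod by lia. lra.
            -- specialize (between (S j)). rewrite mid in between.
               assert (a = 0) by (apply between; lia). lra.
          * destruct (Nat.eq_dec q (S (S j))) as [-> | ne]; [reflexivity | ].
            specialize (between (S (S j))). rewrite pos in between by lia.
            assert (1 = 0) by (apply between; lia). lra.
          * rewrite (pos p), (pos q) in prod by lia. lra.
        + intros [= -> ->]. repeat split; simpl; [lia | | intros; lia].
          rewrite mid, pos by lia. lra.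
      - exists j, (S (S j)). split; [lia | ]. intros p q hp. split.
        + intros (lt & prod & between); simpl in *.
          destruct (pos_cases p) as [? | [Hp | [-> | Hp]]]; [lia | | | ].
          * assert (Hq : (S (S j) <= q)%nat).
            { destruct (pos_cases q) as [? | [Hq | [-> | Hq]]]; [lia | | | lia].
              - rewrite (neg p), (neg q) in prod by lia. lra.
              - rewrite mid in prod. nra. }
            destruct (Nat.eq_dec p j) as [-> | ne].
            -- destruct (Nat.eq_dec q (S (S j))) as [-> | ne]; [reflexivity | ].
               specialize (between (S (S j))). rewrite pos in between by lia.
               assert (1 = 0) by (apply between; lia). lra.
            -- specialize (between j). rewrite neg in between by lia.
               assert (-1 = 0) by (apply between; lia). lra.
          * rewrite mid in prod. nra.
          * rewrite (pos p), (pos q) in prod by lia. lra.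
        + intros [= -> ->]. repeat split; simpl; [lia | | ].
          * rewrite neg, pos by lia. lra.
          * intros n hn. replace n with (S j) by lia. lra.
      - exists j, (S j). split; [lia | ]. intros p q hp. split.
        + intros (lt & prod & between); simpl in *.
          destruct (pos_cases p) as [? | [Hp | [-> | Hp]]]; [lia | | | ].
          * destruct (Nat.eq_dec p j) as [-> | ne].
            -- destruct (Nat.eq_dec q (S j)) as [-> | ne]; [reflexivity | ].
               specialize (between (S j)). rewrite mid in between.
               assert (a = 0) by (apply between; lia). lra.
            -- destruct (pos_cases q) as [? | [Hq | [-> | Hq]]]; [lia | | | ].
               ++ rewrite (neg p), (neg q) in prod by lia. lra.
               ++ specialize (between j). rewrite neg in between by lia.
                  assert (-1 = 0) by (apply between; lia). lra.
               ++ specialize (between j). rewrite neg in between by lia.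
                  assert (-1 = 0) by (apply between; lia). lra.
          * rewrite mid, pos in prod by lia. lra.
          * rewrite (pos p), (pos q) in prod by lia. lra.
        + intros [= -> ->]. repeat split; simpl; [lia | | intros; lia].
          rewrite mid, neg by lia. lra. }
    destruct last as (p & q & hpq & last).
    exists ((0%nat, 1%nat) :: (p, q) :: nil). split; [ | split; [reflexivity | ]].
    + constructor; [ | constructor; [easy | constructor]].
      intros [e | []]. injection e. lia.
    + intros [p' q']. split.
      * intros [[= <- <-] | [[= <- <-] | []]].
        -- repeat split; simpl; [lia | | intros; lia]. rewrite zero, neg by lia. lra.
        -- apply last; [lia | reflexivity].
      * intros sc. destruct (Nat.eq_dec p' 0) as [-> | ne].
        -- left. destruct sc as (lt & prod & between); simpl in *.
           destruct (Nat.eq_dec q' 1) as [-> | ne]; [reflexivity | ].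
           specialize (between 1%nat). rewrite neg in between by lia.
           assert (-1 = 0) by (apply between; lia). lra.
        -- right; left. symmetry. apply last; [lia | exact sc].
Qed.

(** Nonzero derivatives make both zeros simple, and the signs from [star_zero_pair] exclude further
    ones, so the zero sequence is [g, l, 1, 1, ...]. *)
Lemma star_xi2 (j : nat) (a g l : R) :
  (1 <= j)%nat -> 0 < g < l -> l < 1 ->
  PSeries (star j a) g = 0 -> PSeries (star j a) l = 0 -> is_xi 2 (star j a) l.
Proof.
  intros hj hgl hl zg zl.
  destruct (star_zero_pair j a hj g l hgl hl zg zl) as (dg & dl & P1 & P2 & P3).
  assert (der : forall x, 0 < x < 1 ->
    Derive_n (PSeries (star j a)) 1 x = PSeries (PS_derive (star j a)) x).
  { intros x hx. apply Derive_PSeries, inside_unit_disk; [apply star_radius | lra]. }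
  exists (fun n => match n with 1%nat => g | 2%nat => l | _ => 1 end).
  split; [ | reflexivity]. split; [ | split].
  - intros [|[|[|k]]] hk; [lia | lra | lra | lra].
  - intros [|[|[|k]]] hk; [lia | lra | lra | lra].
  - intros x hx.
    destruct (Req_dec x g) as [-> | ng]; [ | destruct (Req_dec x l) as [-> | nl]].
    + exists 1%nat. split.
      * split; [ | rewrite der; lra].
        intros i hi. replace i with 0%nat by lia. exact zg.
      * exists (1%nat :: nil). split; [repeat constructor; easy | split; [easy | ]].
        intros n. split.
        -- intros [<- | []]. split; [lia | reflexivity].
        -- intros [hn e]. destruct n as [|[|[|n]]]; [lia | now left | lra | lra].
    + exists 1%nat. split.
      * split; [ | rewrite der; lra].
        intros i hi. replace i with 0%nat by lia. exact zl.
      * exists (2%nat :: nil). split; [repeat constructor; easy | split; [easy | ]].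
        intros n. split.
        -- intros [<- | []]. split; [lia | reflexivity].
        -- intros [hn e]. destruct n as [|[|[|n]]]; [lia | lra | now left | lra].
    + exists 0%nat. split.
      * split; [intros; lia | ]. change (PSeries (star j a) x <> 0).
        destruct (Rlt_le_dec x g) as [L | G]; [specialize (P1 x); lra | ].
        destruct (Rlt_le_dec x l) as [L' | G']; [specialize (P2 x); lra | ].
        specialize (P3 x); lra.
      * exists nil. split; [constructor | split; [reflexivity | ]].
        intros n. split; [easy | ]. intros [hn e].
        destruct n as [|[|[|n]]]; [lia | lra | lra | lra].
Qed.

Lemma star_Derive_h (j : nat) (a x : R) :
  0 < x < 1 -> Derive (h (S j) a) x = PSeries (PS_derive (star j a)) x.
Proof.
  intros hx. rewrite <- Derive_PSeries
    by (apply inside_unit_disk; [apply star_radius | lra]).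
  symmetry. apply Derive_ext_loc.
  apply (locally_interval _ x 0 1); simpl; [lra | lra | ].
  intros y hy0 hy1. apply PSeries_star_h. rewrite Rabs_pos_eq; lra.
Qed.

Lemma zero_sequence_zero (f s : nat -> R) (k : nat) :
  is_zero_sequence f s -> (1 <= k)%nat -> s k < 1 -> PSeries f (s k) = 0.
Proof.
  intros (bd & _ & mult) hk hs.
  destruct (mult (s k)) as (m & [zeros _] & l & _ & len & mem).
  { split; [now apply bd | exact hs]. }
  apply (zeros 0%nat).
  destruct l as [|i l]; [ | simpl in len; lia].
  now destruct (proj2 (mem k)).
Qed.

Lemma zero_sequence_double (f s : nat -> R) :
  is_zero_sequence f s -> s 1%nat = s 2%nat -> s 2%nat < 1 ->
  exists m, (2 <= m)%nat /\ zero_multiplicity f (s 2%nat) m.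
Proof.
  intros (bd & _ & mult) e hs.
  destruct (mult (s 2%nat)) as (m & zm & l & nd & len & mem).
  { split; [apply bd; lia | exact hs]. }
  exists m. split; [ | exact zm]. rewrite <- len.
  (* The indices 1 and 2 both carry this value, so at least two indices are counted. *)
  apply (NoDup_incl_length (l := (1 :: 2 :: nil)%nat)).
  - repeat constructor; simpl; lia.
  - intros i [<- | [<- | []]]; apply mem; split; trivial; lia.
Qed.

Lemma zero_sequence_first_le (f s : nat -> R) (x : R) :
  is_zero_sequence f s -> 0 < x < 1 -> PSeries f x = 0 -> s 1%nat <= x.
Proof.
  intros (_ & mono & mult) hx zx.
  destruct (mult x hx) as (m & [_ nz] & l & _ & len & mem).
  destruct l as [|k l].
  { simpl in len. subst m. now destruct nz. }
  destruct (proj1 (mem k)) as [hk <-]; [now left | ].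
  clear - mono hk. induction hk as [|k hk IH]; [lra | ].
  specialize (mono k hk). lra.
Qed.

(** * The graph of [phi], as a relation between the two zeros of a star function *)

Definition star_pair (g l : R) : Prop :=
  exists (j : nat) (a : R), (1 <= j)%nat /\ -1 <= a <= 1 /\ g < l < 1 /\
    PSeries (star j a) g = 0 /\ PSeries (star j a) l = 0.

Lemma star_pair_exists
  (alpha2 : R) (hal : is_alpha2 alpha2) (g : R) :
  1 / 2 < g < alpha2 -> exists l, star_pair g l.
Proof.
  intros hg. destruct (alpha2_star alpha2 hal) as [h1 _].
  destruct (star_exists g) as (j & a & hj & ha & z); [lra | ].
  destruct (star_second_zero j a hj g) as (l & hl & zl); trivial; try lra.
  - apply Rnot_le_lt. intros d.
    destruct (alpha2_le_star_zero alpha2 j a g) as [le _]; trivial; lra.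
  - now exists l, j, a.
Qed.

(** The star function with a double zero at [alpha2] is positive at [g], so it exceeds the one of
    the pair there, hence also at [alpha2]. The latter is thus negative at [alpha2], which must lie
    before [l]. *)
Lemma star_pair_separates
  (alpha2 : R) (hal : is_alpha2 alpha2) (g l : R) :
  1 / 2 < g < alpha2 -> star_pair g l -> alpha2 < l.
Proof.
  intros hg (j & a & hj & ha & hl & zg & zl).
  destruct (alpha2_star alpha2 hal) as [h1 (j0 & a0 & hj0 & ha0 & z0 & d0)].
  assert (lt : PSeries (star j a) g < PSeries (star j0 a0) g).
  { rewrite zg, <- z0. apply star_decreasing; trivial; lra. }
  apply (star_total j j0 a a0 g alpha2) in lt; trivial; try lra.
  destruct (star_zero_pair j a hj g l) as (_ & _ & _ & _ & P3); trivial; try lra.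
  apply Rnot_le_lt. intros [L | <-]; [specialize (P3 alpha2); lra | lra].
Qed.

(** The second function is positive at [g1], before its first zero, so it exceeds the first one
    there and hence at [l2]. The first is thus negative at [l2]. *)
Lemma star_pair_decreasing (g1 g2 l1 l2 : R) :
  0 < g1 < g2 -> star_pair g1 l1 -> star_pair g2 l2 -> l2 < l1.
Proof.
  intros hg (j1 & a1 & hj1 & ha1 & hl1 & zg1 & zl1)
    (j2 & a2 & hj2 & ha2 & hl2 & zg2 & zl2).
  destruct (star_zero_pair j1 a1 hj1 g1 l1) as (_ & _ & _ & _ & P); trivial; try lra.
  destruct (star_zero_pair j2 a2 hj2 g2 l2) as (_ & _ & Q & _); trivial; try lra.
  assert (lt : PSeries (star j1 a1) g1 < PSeries (star j2 a2) g1).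
  { rewrite zg1. apply Q; lra. }
  apply (star_total j1 j2 a1 a2 g1 l2) in lt; trivial; try lra.
  apply Rnot_le_lt. intros [L | ->]; [specialize (P l2); lra | lra].
Qed.

(** By [star_extremal], each of the two functions bounds the other from above to the right of [g],
    so they agree at [l']. *)
Lemma star_pair_unique (g l l' : R) :
  0 < g -> star_pair g l -> star_pair g l' -> l' = l.
Proof.
  intros hg (j & a & hj & ha & hl & zg & zl) (j' & a' & hj' & ha' & hl' & zg' & zl').
  destruct (star_zero_pair j a hj g l) as (_ & _ & _ & N & P); trivial; try lra.
  assert (z : PSeries (star j a) l' = 0).
  { apply Rle_antisym.
    - destruct (star_extremal (star j a) j' a' g) as [-> | (_ & lt & _)];
        trivial; try lra; [now apply star_in_B | ].
      specialize (lt l'). lra.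
    - destruct (star_extremal (star j' a') j a g) as [<- | (_ & lt & _)];
        trivial; try lra; [now apply star_in_B | ].
      specialize (lt l'). lra. }
  destruct (Rtotal_order l' l) as [L | [E | G]];
    [specialize (N l') | trivial | specialize (P l')]; lra.
Qed.

(** The star function vanishing at [l] lies below the one with a double zero at [alpha2]: the latter
    has become positive at [l]. So it is negative at [alpha2], while positive at 1/2. *)
Lemma star_pair_onto
  (alpha2 : R) (hal : is_alpha2 alpha2) (l : R) :
  alpha2 < l < 1 -> exists g, 1 / 2 < g < alpha2 /\ star_pair g l.
Proof.
  intros hl.
  destruct (alpha2_star alpha2 hal) as [h1 (j0 & a0 & hj0 & ha0 & z0 & d0)].
  destruct (star_exists l) as (j & a & hj & ha & zl); [lra | ].
  assert (lt : PSeries (star j a) l < PSeries (star j0 a0) l).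
  { rewrite zl, <- z0. apply star_increasing; trivial; lra. }
  apply (star_total j j0 a a0 l alpha2) in lt; trivial; try lra.
  destruct (IVT_inside_decr (star j a) (1 / 2) alpha2) as (g & hg & zg);
    [apply star_radius | lra | lra | apply star_pos_le_half; lra | lra | ].
  exists g. split; [lra | ]. exists j, a. repeat split; trivial; lra.
Qed.

Lemma star_pair_Omega_plus (g l x : R) :
  0 < g -> star_pair g l -> g < x < l -> ~ Omega_plus g x.
Proof.
  intros hg (j & a & hj & ha & hl & zg & zl) hx (_ & _ & _ & f & hf & [_ fg] & [_ fx]).
  destruct (star_zero_pair j a hj g l) as (_ & _ & _ & N & _); trivial; try lra.
  specialize (N x hx).
  destruct (star_extremal f j a g) as [-> | (_ & lt & _)]; trivial; try lra.
  specialize (lt x). lra.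
Qed.

Lemma star_pair_xi2_minimum
  (alpha2 : R) (hal : is_alpha2 alpha2) (g l : R) :
  1 / 2 < g < alpha2 -> star_pair g l -> is_minimum (xi2_values g) l.
Proof.
  intros hg pair. pose proof pair as (j & a & hj & ha & hl & zg & zl).
  destruct (alpha2_star alpha2 hal) as [h1 _].
  destruct (star_zero_pair j a hj g l) as (_ & _ & P & _); trivial; try lra.
  split.
  - exists (star j a). split; [now apply star_in_B | split].
    + split; [rewrite Rabs_pos_eq; lra | exact zg].
    + apply (star_xi2 j a g l); trivial; lra.
  - intros x (f & hf & fg & s & hs & <-).
    assert (zf := proj2 fg).
    (* The conventional value 1, for fewer than two zeros, exceeds [l]. *)
    destruct (Rlt_le_dec (s 2%nat) 1) as [s2 | ]; [ | lra].
    assert (fpos : forall y, 0 < y < g -> 0 < PSeries f y).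
    { intros y hy. specialize (P y hy).
      destruct (star_extremal f j a g) as [-> | (lt & _)]; trivial; try lra.
      specialize (lt y hy). lra. }
    pose proof hs as (bd & mono & _).
    assert (s1g : s 1%nat = g).
    { pose proof (zero_sequence_first_le f s g hs) as le1.
      pose proof (zero_sequence_zero f s 1 hs (le_n 1)) as z1.
      specialize (fpos (s 1%nat)). specialize (bd 1%nat (le_n 1)).
      destruct (Rlt_le_dec (s 1%nat) g); [ | lra].
      rewrite z1 in fpos; lra. }
    specialize (mono 1%nat (le_n 1)).
    destruct (Rle_lt_or_eq_dec _ _ mono) as [lt | eq].
    + apply Rnot_lt_le. intros gap.
      apply (star_pair_Omega_plus g l (s 2%nat)); trivial; try lra.
      repeat split; try lra. exists f. split; [exact hf | split; [exact fg | ]].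
      split; [rewrite Rabs_pos_eq; lra | ].
      apply zero_sequence_zero; trivial; lia.
    (* A double zero at [g] contradicts [g < alpha2]. *)
    + destruct (zero_sequence_double f s hs eq s2) as (m & hm & zm).
      assert (alpha2 <= s 2%nat); [ | lra].
      apply hal. split; [lra | ]. now exists f, m.
Qed.

Theorem proposition2p2 (alpha2 : R) (Halpha2 : is_alpha2 alpha2) :
  exists phi : R -> R,
    ((forall g : R, 1 / 2 < g < alpha2 -> is_minimum (xi2_values g) (phi g)) /\
     (forall g : R, 1 / 2 < g < alpha2 -> continuous phi g) /\
     (forall g1 g2 : R, 1 / 2 < g1 -> g1 < g2 -> g2 < alpha2 ->
        phi g2 < phi g1) /\
     filterlim phi (at_right (1 / 2)) (locally 1) /\
     filterlim phi (at_left alpha2) (locally alpha2)) /\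
    (forall g : R, 1 / 2 < g < alpha2 ->
       forall l : R, g < l < phi g -> ~ Omega_plus g l) /\
    (forall g : R, 1 / 2 < g < alpha2 ->
       exists f : nat -> R,
         unique (fun b : nat -> R =>
                   in_B b /\ is_zero b g /\ is_zero b (phi g)) f /\
         star_function f /\
         exists (k : nat) (a : R),
           (1 <= k)%nat /\ -1 <= a <= 1 /\
           (forall x : R, Rabs x < 1 -> PSeries f x = h k a x) /\
           h k a g = 0 /\ h k a (phi g) = 0 /\
           Derive (h k a) g < 0 /\ 0 < Derive (h k a) (phi g)).
Proof.
  destruct (alpha2_star alpha2 Halpha2) as [h1 _].
  (* Choice needs a total relation, so the values of [phi] outside the interval are left
     arbitrary. *)
  destruct (functional_choice
    (fun g l => 1 / 2 < g < alpha2 -> star_pair g l)) as [phi hphi].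
  { intros g. destruct (classic (1 / 2 < g < alpha2)) as [hg | hg].
    - destruct (star_pair_exists alpha2 Halpha2 g hg) as [l hl]. now exists l.
    - exists 0. intros H. contradiction. }
  assert (decr : forall g1 g2, 1 / 2 < g1 -> g1 < g2 -> g2 < alpha2 ->
            phi g2 < phi g1).
  { intros g1 g2 H1 H2 H3. apply (star_pair_decreasing g1 g2); [lra | | ];
      apply hphi; lra. }
  assert (range : forall g, 1 / 2 < g < alpha2 -> alpha2 < phi g < 1).
  { intros g hg. split.
    - apply (star_pair_separates alpha2 Halpha2 g); auto.
    - destruct (hphi g hg) as (j & a & _ & _ & hl & _). lra. }
  assert (onto : forall l, alpha2 < l < 1 ->
            exists g, 1 / 2 < g < alpha2 /\ phi g = l).
  { intros l hl. destruct (star_pair_onto alpha2 Halpha2 l hl) as (g & hg & pair).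
    exists g. split; [exact hg | ].
    apply (star_pair_unique g); auto. lra. }
  exists phi. split; [ | split].
  - split; [ | split; [ | split; [exact decr | split]]].
    + intros g hg. apply (star_pair_xi2_minimum alpha2); auto.
    (* Cutting the band around [phi g] down to (alpha2, 1) makes its values attained. Preimages of
       one value on each side of [phi g] bracket [g], and monotonicity confines [phi] between
       them. *)
    + intros g hg. apply filterlim_locally. intros [eps heps].
      pose proof (range g hg) as hl.
      pose proof (Rmax_l (phi g - eps) alpha2). pose proof (Rmax_r (phi g - eps) alpha2).
      pose proof (Rmin_l (phi g + eps) 1). pose proof (Rmin_r (phi g + eps) 1).
      assert (Rmax (phi g - eps) alpha2 < phi g) by (apply Rmax_lub_lt; lra).
      assert (phi g < Rmin (phi g + eps) 1) by (apply Rmin_glb_lt; lra).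
      destruct (onto ((Rmax (phi g - eps) alpha2 + phi g) / 2)) as (g2 & hg2 & e2);
        [lra | ].
      destruct (onto ((Rmin (phi g + eps) 1 + phi g) / 2)) as (g1 & hg1 & e1);
        [lra | ].
      assert (g1 < g).
      { apply Rnot_le_lt. intros [L | ->]; [ | lra].
        specialize (decr g g1). lra. }
      assert (g < g2).
      { apply Rnot_le_lt. intros [L | ->]; [ | lra].
        specialize (decr g2 g). lra. }
      apply (locally_interval _ g g1 g2); simpl; trivial.
      intros y hy1 hy2. apply Rabs_def1; unfold minus, plus, opp; simpl.
      * specialize (decr g1 y). lra.
      * specialize (decr y g2). lra.
    (* At both ends [range] gives one of the two bounds; the other comes from [decr] and a preimage
       of a value close to the limit. *)
    + apply filterlim_locally. intros [eps heps].
      pose proof (Rmax_l (1 - eps) alpha2). pose proof (Rmax_r (1 - eps) alpha2).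
      assert (Rmax (1 - eps) alpha2 < 1) by (apply Rmax_lub_lt; lra).
      destruct (onto ((Rmax (1 - eps) alpha2 + 1) / 2)) as (g1 & hg1 & e1); [lra | ].
      apply (locally_interval _ (1 / 2) m_infty g1); simpl; trivial; [lra | ].
      intros y _ hy1 hy2. specialize (decr y g1). specialize (range y).
      apply Rabs_def1; unfold minus, plus, opp; simpl; lra.
    + apply filterlim_locally. intros [eps heps].
      pose proof (Rmin_l (alpha2 + eps) 1). pose proof (Rmin_r (alpha2 + eps) 1).
      assert (alpha2 < Rmin (alpha2 + eps) 1) by (apply Rmin_glb_lt; lra).
      destruct (onto ((Rmin (alpha2 + eps) 1 + alpha2) / 2))
        as (g1 & hg1 & e1); [lra | ].
      apply (locally_interval _ alpha2 g1 p_infty); simpl; trivial; [lra | ].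
      intros y hy1 _ hy2. specialize (decr g1 y). specialize (range y).
      apply Rabs_def1; unfold minus, plus, opp; simpl; lra.
  - intros g hg l hl. apply (star_pair_Omega_plus g (phi g)); auto; lra.
  - intros g hg. specialize (range g hg).
    destruct (hphi g hg) as (j & a & hj & ha & hl & zg & zl).
    destruct (star_zero_pair j a hj g (phi g)) as (dg & dl & _); trivial; try lra.
    assert (ig : Rabs g < 1) by (rewrite Rabs_pos_eq; lra).
    assert (il : Rabs (phi g) < 1) by (rewrite Rabs_pos_eq; lra).
    exists (star j a). split; [ | split; [now apply star_star_function | ]].
    + split.
      * repeat split; trivial; now apply star_in_B.
      (* Any other function of the class vanishing at [g] is strictly below the star function at
         [phi g], hence nonzero there. *)
      * intros f (hf & [_ fg] & [_ fl]).
        destruct (star_extremal f j a g) as [-> | (_ & lt & _)]; trivial; try lra.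
        specialize (lt (phi g)). lra.
    + exists (S j), a. split; [lia | split; [exact ha | ]].
      rewrite !star_Derive_h, <- !PSeries_star_h by (trivial; lra).
      repeat split; trivial. intros x. apply PSeries_star_h.
Qed.
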